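(* Let $(\mathfrak g,[\cdot,\cdot]_{\mathfrak g},\rhd)$ be a post-Lie algebra over $\mathbf k$. Then the antipode $S_\rhd$ of the sub-adjacent Hopf algebra $\mathrm U(\mathfrak g)_\rhd$ is given by $$S_\rhd(x_1\cdots x_m)=(-1)^m\sum_\pi [x_{B_1};x_{b_1}]\,[x_{B_2};x_{b_2}]\cdots[x_{B_{|\pi|-1}};x_{b_{|\pi|-1}}],\qquad \forall\, x_1,\dots,x_m\in\mathfrak g,$$ where $x_1\cdots x_m$ and the products on the right are taken in $\mathrm U(\mathfrak g)$ with its usual multiplication, and the sum ranges over all partitions $\pi$ of $[m]=\{1,\dots,m\}$ into a tuple $(B_1,\dots,B_{|\pi|})$ of pairwise disjoint, possibly empty subsets with union $[m]$, such that the last one has exactly $|\pi|-1$ elements, written $B_{|\pi|}=\{b_1>\cdots>b_{|\pi|-1}\}$. Here, for $I=\{i_1<\cdots<i_r\}\subseteq[m]$ and $y\in\mathfrak g$, $[x_I;y]:=\sum_{w\in S_r}[x_{i_1},\dots,x_{i_r};y]_w\in\mathfrak g$, and $[x_\emptyset;y]=y$.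
   Context: $\mathbf k$ is an algebraically closed field of characteristic $0$; everything is over $\mathbf k$. Sweedler notation: $\Delta(u)=u_1\otimes u_2$ (summation suppressed). A post-Lie algebra $(\mathfrak g,[\cdot,\cdot]_{\mathfrak g},\rhd)$ is a Lie algebra $(\mathfrak g,[\cdot,\cdot]_{\mathfrak g})$ with a bilinear product $\rhd:\mathfrak g\otimes\mathfrak g\to\mathfrak g$ such that $x\rhd[y,z]_{\mathfrak g}=[x\rhd y,z]_{\mathfrak g}+[y,x\rhd z]_{\mathfrak g}$ and $([x,y]_{\mathfrak g}+x\rhd y-y\rhd x)\rhd z=x\rhd(y\rhd z)-y\rhd(x\rhd z)$. The product $\rhd$ extends to the universal enveloping algebra $\mathrm U(\mathfrak g)$ (with its usual Hopf algebra structure: multiplication, $\Delta$, $\varepsilon$, $S$) recursively by: $x\rhd 1=0$, $x\rhd x_1\cdots x_r=\sum_{i=1}^r x_1\cdots(x\rhd x_i)\cdots x_r$, $1\rhd u=u$, and $x_1\cdots x_r\rhd u=x_1\rhd(x_2\cdots x_r\rhd u)-(x_1\rhd x_2\cdots x_r)\rhd u$, for $x,x_1,\dots,x_r\in\mathfrak g$, $u\in\mathrm U(\mathfrak g)$, $r\ge1$ (this is known to be well defined). The sub-adjacent Hopf algebra is $\mathrm U(\mathfrak g)_\rhd=(\mathrm U(\mathfrak g),\circ,1,\Delta,\varepsilon,S_\rhd)$ with the same unit, coproduct and counit as $\mathrm U(\mathfrak g)$, product $u\circ v=u_1\,(u_2\rhd v)$, and antipode denoted $S_\rhd$ (it is known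 to be a Hopf algebra). Definition of $[x_1,\dots,x_r;y]_w\in\mathfrak g$ for $x_1,\dots,x_r,y\in\mathfrak g$ and a permutation $w\in S_r$: start with the sequence $x_{w(1)},x_{w(2)},\dots,x_{w(r)},y$. For $k=1,2,\dots,r$ successively, take the entry of the current sequence which involves $x_k$ (the entry into which $x_k$ currently enters, treating $x_1,\dots,x_r$ as formal symbols), call it $A$, and let $C$ be the entry immediately to its right; replace the two adjacent entries $A,C$ by the single entry $A\rhd C$. After $r$ steps one entry remains, and it is $[x_1,\dots,x_r;y]_w$. For example, $[x_1,\dots,x_6;y]_{256314}=((x_2\rhd x_5)\rhd x_6)\rhd((x_3\rhd(x_1\rhd x_4))\rhd y)$ (with $w$ in one-line notation). *)

(* Defs.v *)
From HB Require Import structures.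
From mathcomp Require Import all_boot all_order all_fingroup all_algebra.
From mathcomp Require Import boolp.

Set Implicit Arguments.
Unset Strict Implicit.
Unset Printing Implicit Defensive.

Import GRing.Theory.
Local Open Scope ring_scope.

Definition bilinear_map (k : fieldType) (V W X : lmodType k)
    (f : V -> W -> X) : Prop :=
  (forall v, linear (f v)) /\ (forall w, linear (f^~ w)).

HB.mixin Record isLieAlgebra (k : fieldType) (g : Type)
    of GRing.Lmodule k g := {
  lie : g -> g -> g;
  lie_bilinear : bilinear_map lie;
  lie_alt : forall x, lie x x = 0;
  lie_jacobi : forall x y z,
    lie x (lie y z) + lie y (lie z x) + lie z (lie x y) = 0
}.

#[short(type="lieAlgType")]
HB.structure Definition LieAlgebra (k : fieldType) :=
  { g of isLieAlgebra k g & GRing.Lmodule k g }.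

HB.mixin Record isPostLie (k : fieldType) (g : Type) of LieAlgebra k g := {
  rhd : g -> g -> g;
  rhd_bilinear : bilinear_map rhd;
  rhd_lie : forall x y z : g,
    rhd x (lie y z) = lie (rhd x y) z + lie y (rhd x z);
  lie_rhd : forall x y z : g,
    rhd (lie x y + rhd x y - rhd y x) z =
    rhd x (rhd y z) - rhd y (rhd x z)
}.

#[short(type="postLieAlgType")]
HB.structure Definition PostLie (k : fieldType) :=
  { g of isPostLie k g & LieAlgebra k g }.

Definition lie_to_alg (k : fieldType) (g : lieAlgType k) (A : algType k)
    (f : g -> A) : Prop :=
  linear f /\ forall x y, f (lie x y) = f x * f y - f y * f x.

(* Universal property of U(g).  Excluding the zero algebra (an [algType] is
   nonzero) changes nothing: U(g) is nonzero, and maps to 0 are trivial. *)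
Record is_enveloping_algebra (k : fieldType) (g : lieAlgType k)
    (U : algType k) (iota : g -> U) : Prop := {
  enveloping_lie : lie_to_alg iota;
  enveloping_univ : forall (A : algType k) (f : g -> A), lie_to_alg f ->
    exists F : {lrmorphism U -> A}, (forall x, F (iota x) = f x) /\
      forall G : {lrmorphism U -> A}, (forall x, G (iota x) = f x) -> G =1 F
}.

Record is_tensor_product_algebra (k : fieldType) (U V T : algType k)
    (tens : U -> V -> T) : Prop := {
  tens_bilinear : bilinear_map tens;
  tens_univ : forall (W : lmodType k) (f : U -> V -> W), bilinear_map f ->
    exists F : {linear T -> W}, (forall u v, F (tens u v) = f u v) /\
      forall G : {linear T -> W}, (forall u v, G (tens u v) = f u v) -> G =1 F;
  tens_one : tens 1 1 = 1;
  tens_mul : forall u v u' v',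
    tens u v * tens u' v' = tens (u * u') (v * v')
}.

(* Value at [t] of the linear map induced by [f]; for t = Delta(u) this is the
   Sweedler sum of the f(u_1, u_2).  The 0 branch is not reached when [tens] is
   a tensor product and [f] is bilinear. *)
Definition tensor_lift (k : fieldType) (U V T : algType k)
    (tens : U -> V -> T) (W : lmodType k) (f : U -> V -> W) (t : T) : W :=
  if pselect (exists F : {linear T -> W}, forall u v, F (tens u v) = f u v)
    is left h then projT1 (cid h) t else 0.

Definition is_antipode (k : fieldType) (U T : algType k) (tens : U -> U -> T)
    (mul : U -> U -> U) (one : U) (Delta : U -> T) (eps : U -> k)
    (S : U -> U) : Prop :=
  [/\ linear S,
      forall u, tensor_lift tens (fun a b => mul (S a) b) (Delta u)
                = eps u *: one
    & forall u, tensor_lift tens (fun a b => mul a (S b)) (Delta u)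
                = eps u *: one].

Definition word (k : fieldType) (g : lmodType k) (U : algType k)
    (iota : g -> U) (s : seq g) : U := \prod_(x <- s) iota x.

Record is_rhd_extension (k : fieldType) (g : postLieAlgType k)
    (U : algType k) (iota : g -> U) (ext : U -> U -> U) : Prop := {
  ext_bilinear : bilinear_map ext;
  ext_gen1 : forall x, ext (iota x) 1 = 0;
  ext_gen_word : forall x s,
    ext (iota x) (word iota s) =
    \sum_(i < size s) word iota (set_nth 0 s i (rhd x s`_i));
  ext_1 : forall u, ext 1 u = u;
  ext_word : forall x s u,
    ext (word iota (x :: s)) u =
    ext (iota x) (ext (word iota s) u) - ext (ext (iota x) (word iota s)) u
}.

Definition subadjacent_mul (k : fieldType) (U T : algType k)
    (tens : U -> U -> T) (Delta : U -> T) (ext : U -> U -> U) (u v : U) : U :=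
  tensor_lift tens (fun u1 u2 => u1 * ext u2 v) (Delta u).

Section Bracket.
Variables (k : fieldType) (g : postLieAlgType k).

(* An entry is an element of g together with the list of the indices of the
   formal symbols it involves.  When the indices are processed in increasing
   order, each entry but the last involves exactly one unprocessed index and
   the last one none, so the entry containing [i] has a right neighbour. *)
Fixpoint merge_at (r : nat) (s : seq (seq 'I_r * g)) (i : 'I_r) :
    seq (seq 'I_r * g) :=
  if s is A :: ((C :: s') as t) then
    if i \in A.1 then (A.1 ++ C.1, rhd A.2 C.2) :: s' else A :: merge_at t i
  else s.

Definition perm_bracket (r : nat) (x : 'I_r -> g) (y : g) (w : 'S_r) : g :=
  let start := rcons [seq ([:: w i], x (w i)) | i <- enum 'I_r] ([::], y) in
  (head ([::], y) (foldl (@merge_at r) start (enum 'I_r))).2.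

(* [enum_val] lists a set of ordinals in increasing order. *)
Definition set_bracket (m : nat) (x : 'I_m -> g) (I : {set 'I_m}) (y : g) : g :=
  \sum_(w : 'S_#|I|) perm_bracket (fun j => x (enum_val j)) y w.

(* Tuples of n+1 blocks, the last one, [B ord_max], having n elements. *)
Definition is_partition (m n : nat) (B : {ffun 'I_n.+1 -> {set 'I_m}}) : bool :=
  [&& [forall i, forall j, (i != j) ==> [disjoint B i & B j]],
      \bigcup_i B i == [set: 'I_m] & #|B ord_max| == n].

(* The default 0 is not used when [B] satisfies [is_partition]: the list of
   the x_b, for b decreasing in the last block, then has size n. *)
Definition partition_term (U : algType k) (iota : g -> U) (m n : nat)
    (x : 'I_m -> g) (B : {ffun 'I_n.+1 -> {set 'I_m}}) : U :=
  \prod_(j < n)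
    iota (set_bracket x (B (widen_ord (leqnSn n) j))
                        [seq x b | b <- rev (enum (B ord_max))]`_j).

End Bracket.

(* Main.v *)
(* Write [u ** v] for the product of the sub-adjacent Hopf algebra.  As
   [x u = x ** u - x |> u] for [x] in [g], the antipode satisfies
     S (x u) = - S u ** x - S (x |> u),
   where [x |> u] is again a combination of words of the same length.  Hence the
   values of S on words are determined by induction on the length, once
   [S u ** x] is known.  S commutes with the coproduct and [**] acts through
   [|>], so [S u ** x] is the sum of the [S u_1 (S u_2 |> x)], and
   [S (x_1 .. x_r) |> y] is, up to sign, [x_{1..r}; y]: both obey the
   recursion obtained by letting [x_1] act on [x_2], .., [x_r] and [y] in turn.
   The partition sum obeys the recursion of S: if 1 lies in some block B_j other
   than the last one, x_1 is absorbed by an entry of B_j or by x_{b_j}, which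
   gives the term S (x |> u); if 1 lies in the last block, it is the least
   element there, and the last factor is [x_J; x_1] with J an arbitrary subset,
   which gives S u ** x. *)
Require Import Defs.
From HB Require Import structures.
From mathcomp Require Import all_boot all_order all_fingroup all_algebra.
From mathcomp Require Import boolp.

Set Implicit Arguments.
Unset Strict Implicit.
Unset Printing Implicit Defensive.

Import GRing.Theory.
Local Open Scope ring_scope.

(** * Linear and bilinear maps *)

Section Linearity.
Variable k : fieldType.
Implicit Types V W X Y : lmodType k.

Definition lin_pack V W (f : V -> W) (fL : linear f) : {linear V -> W} :=
  HB.pack f (GRing.isLinear.Build _ _ _ _ f fL).

Section Rules.
Variables (V W : lmodType k) (f : V -> W) (fL : linear f).

Lemma lin0 : f 0 = 0.
Proof. exact: (linear0 (lin_pack fL)). Qed.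

Lemma linD : {morph f : u v / u + v}.
Proof. exact: (linearD (lin_pack fL)). Qed.

Lemma linN : {morph f : u / - u}.
Proof. exact: (linearN (lin_pack fL)). Qed.

Lemma linB : {morph f : u v / u - v}.
Proof. exact: (linearB (lin_pack fL)). Qed.

Lemma linZ a : {morph f : u / a *: u}.
Proof. by move=> u; rewrite -[a *: u]addr0 fL lin0 addr0. Qed.

Lemma lin_sum I r (P : pred I) (E : I -> V) :
  f (\sum_(i <- r | P i) E i) = \sum_(i <- r | P i) f (E i).
Proof. exact: (linear_sum (lin_pack fL)). Qed.

End Rules.

Lemma lin_id V : linear (fun u : V => u).
Proof. by []. Qed.

Lemma lin_zero V W : linear (fun u : V => 0 : W).
Proof. by move=> a u v; rewrite scaler0 addr0. Qed.

Lemma lin_comp V W X (f : W -> X) (h : V -> W) :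
  linear f -> linear h -> linear (fun u => f (h u)).
Proof. by move=> fL hL a u v; rewrite hL fL. Qed.

Lemma lin_add V W (f h : V -> W) :
  linear f -> linear h -> linear (fun u => f u + h u).
Proof. by move=> fL hL a u v; rewrite fL hL scalerDr addrACA. Qed.

Lemma lin_opp V W (f : V -> W) : linear f -> linear (fun u => - f u).
Proof. by move=> fL a u v; rewrite fL opprD scalerN. Qed.

Lemma lin_sub V W (f h : V -> W) :
  linear f -> linear h -> linear (fun u => f u - h u).
Proof. by move=> fL hL; apply: lin_add => //; apply: lin_opp. Qed.

Lemma bil_add V W X (f h : V -> W -> X) :
  bilinear_map f -> bilinear_map h -> bilinear_map (fun a b => f a b + h a b).
Proof. by move=> [f1 f2] [h1 h2]; split=> v; apply: lin_add. Qed.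

Lemma bil_comp V W V' W' X (f : V -> W -> X) (p : V' -> V) (q : W' -> W) :
  bilinear_map f -> linear p -> linear q ->
  bilinear_map (fun a b => f (p a) (q b)).
Proof.
move=> [f1 f2] pL qL; split=> v.
  exact: (lin_comp (f1 _) qL).
exact: (lin_comp (f2 _) pL).
Qed.

Lemma lin_bil V W X Y (f : V -> W -> X) (h : X -> Y) :
  linear h -> bilinear_map f -> bilinear_map (fun a b => h (f a b)).
Proof.
move=> hL [f1 f2]; split=> v; first exact: (lin_comp hL (f1 _)).
exact: (lin_comp hL (f2 _)).
Qed.

Lemma bil_mul (A : algType k) : bilinear_map (fun a b : A => a * b).
Proof.
split=> v a u w; first by rewrite mulrDr scalerAr.
by rewrite mulrDl scalerAl.
Qed.

Lemma mull_lin (A : algType k) (c : A) : linear (fun b : A => c * b).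
Proof. exact: (bil_mul A).1. Qed.
Lemma mulr_lin (A : algType k) (c : A) : linear (fun a : A => a * c).
Proof. exact: (bil_mul A).2. Qed.

End Linearity.

(** * Words span the enveloping algebra *)

Section Generation.
Variables (k : fieldType) (A : algType k) (T : Type) (iota : T -> A).

Inductive generated : A -> Prop :=
| gen_one : generated 1
| gen_mul x u : generated u -> generated (iota x * u)
| gen_lin a u v : generated u -> generated v -> generated (a *: u + v).

Definition gen_pred : {pred A} := fun u => `[< generated u >].

Lemma gen_predP u : reflect (generated u) (u \in gen_pred).
Proof. exact: asboolP. Qed.

Lemma generatedM u v : generated u -> generated v -> generated (u * v).
Proof.
move=> gu gv; elim: gu => [|x {}u _ IH|a {}u w _ IHu _ IHw].
- by rewrite mul1r.
- by rewrite -mulrA; constructor.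
- by rewrite mulrDl -scalerAl; constructor.
Qed.

Fact gen_subalg : subalg_closed gen_pred.
Proof.
split; first by apply/gen_predP; constructor.
  by move=> a u v /gen_predP gu /gen_predP gv; apply/gen_predP; constructor.
by move=> u v /gen_predP gu /gen_predP gv; apply/gen_predP/generatedM.
Qed.

HB.instance Definition _ := GRing.isSubalgClosed.Build k A gen_pred gen_subalg.

(** The generated subalgebra as an algebra of its own, so that the universal property can map into
    it. *)
Record gen_alg := GenAlg { gen_val : A; _ : gen_val \in gen_pred }.

HB.instance Definition _ := [isSub of gen_alg for gen_val].
HB.instance Definition _ := [Choice of gen_alg by <:].
HB.instance Definition _ := [SubChoice_isSubAlgebra of gen_alg by <:].

End Generation.

Section EnvelopingInduction.
Variables (k : fieldType) (g : lieAlgType k) (U : algType k) (iota : g -> U).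
Hypothesis U_env : is_enveloping_algebra iota.

(** The universal property gives a morphism from [U] to the generated subalgebra; followed by the
    inclusion it fixes [iota], so by uniqueness it is the identity of [U]. *)
Lemma env_generated u : generated iota u.
Proof.
have [iotaL iotaM] := enveloping_lie U_env.
have gi x : iota x \in gen_pred iota.
  by apply/gen_predP; rewrite -[iota x]mulr1; do 2!constructor.
pose f x : gen_alg iota := GenAlg (gi x).
have fL : lie_to_alg f.
  split=> [a x y|x y]; apply: val_inj; first by rewrite linearP /= iotaL.
  by rewrite rmorphB !rmorphM /= iotaM.
have [F [FE _]] := enveloping_univ U_env fL.
have [G [_ Guniq]] := enveloping_univ U_env (enveloping_lie U_env).
pose vL : {linear gen_alg iota -> U} := (val : gen_alg iota -> U).
pose vM : {rmorphism gen_alg iota -> U} := (val : gen_alg iota -> U).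
pose v : {lrmorphism gen_alg iota -> U} :=
  HB.pack (val : gen_alg iota -> U)
    (GRing.Linear.class vL) (GRing.RMorphism.class vM).
have vF x : (v \o F) (iota x) = iota x by rewrite /= FE.
have := Guniq [the {lrmorphism U -> U} of v \o F] vF u.
have -> : G u = u by rewrite -(Guniq [the {lrmorphism U -> U} of idfun]).
move=> <- /=.
by apply/gen_predP; case: (F u).
Qed.

Lemma env_ind (P : U -> Prop) :
  P 1 -> (forall x u, P u -> P (iota x * u)) ->
  (forall a u v, P u -> P v -> P (a *: u + v)) -> forall u, P u.
Proof.
move=> P1 PM PL u; elim: (env_generated u) => // *; [exact: PM|exact: PL].
Qed.

Lemma env_ext (W : lmodType k) (f h : U -> W) :
  linear f -> linear h -> (forall s, f (word iota s) = h (word iota s)) ->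
  f =1 h.
Proof.
move=> fL hL fh u.
suff [l ->] : exists l : seq (k * seq g), u = \sum_(p <- l) p.1 *: word iota
  p.2.
  rewrite (lin_sum fL) (lin_sum hL); apply: eq_bigr => p _.
  by rewrite (linZ fL) (linZ hL) fh.
elim/env_ind: u => [|x u [l ->]|a u v [l ->] [l' ->]].
- by exists [:: (1, [::])]; rewrite big_seq1 scale1r /word big_nil.
- exists [seq (p.1, x :: p.2) | p <- l]; rewrite big_map mulr_sumr.
  by apply: eq_bigr => p _; rewrite /word big_cons -scalerAr.
- exists ([seq (a * p.1, p.2) | p <- l] ++ l').
  rewrite big_cat big_map scaler_sumr; congr (_ + _).
  by apply: eq_bigr => p _; rewrite scalerA.
Qed.

End EnvelopingInduction.

(** * The universal property of the tensor product *)

Section Tensor.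
Variables (k : fieldType) (U V UV : algType k) (tens : U -> V -> UV).
Hypothesis tensP : is_tensor_product_algebra tens.

Lemma tens_ext (W : lmodType k) (f h : UV -> W) :
  linear f -> linear h -> (forall a b, f (tens a b) = h (tens a b)) -> f =1 h.
Proof.
move=> fL hL fh t.
have [F [_ Funiq]] := tens_univ tensP (lin_bil fL (tens_bilinear tensP)).
have fF := Funiq (lin_pack fL) (fun _ _ => erefl) t.
by rewrite -[f t]/(lin_pack fL t) fF -(Funiq (lin_pack hL)).
Qed.

Lemma tensor_lift_lin (W : lmodType k) (f : U -> V -> W) :
  linear (tensor_lift tens f).
Proof.
rewrite /tensor_lift; case: pselect => [h|_]; last exact: lin_zero.
exact: linearP.
Qed.

Lemma tensor_liftE (W : lmodType k) (f : U -> V -> W) a b :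
  bilinear_map f -> tensor_lift tens f (tens a b) = f a b.
Proof.
move=> fB; rewrite /tensor_lift; case: pselect => [h|[]];
  first exact: (projT2 (cid h)).
by have [F [FE _]] := tens_univ tensP fB; exists F.
Qed.

End Tensor.
(** * The sub-adjacent Hopf algebra and its antipode *)

Section Words.
Variable T : Type.

Fixpoint deriv_seq (d : T -> T) (s : seq T) : seq (seq T) :=
  if s is y :: s' then (d y :: s') :: map (cons y) (deriv_seq d s') else [::].

(* Indexes the terms of the coproduct of a product of primitive elements. *)
Fixpoint unshuffle (s : seq T) : seq (seq T * seq T) :=
  if s is x :: s' then
    [seq (x :: p.1, p.2) | p <- unshuffle s'] ++
    [seq (p.1, x :: p.2) | p <- unshuffle s']
  else [:: ([::], [::])].

Lemma size_deriv_seq d s : all (fun t => size t == size s) (deriv_seq d s).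
Proof.
elim: s => //= y s IH; rewrite eqxx all_map; apply: sub_all IH => t.
by rewrite /= eqSS.
Qed.

Lemma size_unshuffle s :
  all (fun p => (size p.1 + size p.2)%N == size s) (unshuffle s).
Proof.
elim: s => //= x s IH; rewrite all_cat !all_map.
by apply/andP; split; apply: sub_all IH => p /= /eqP <-; rewrite ?addnS ?eqxx.
Qed.

(** The head stands for the term [tens u 1] of the coproduct; all other terms have a shorter left
    factor, which allows inductions on length. *)
Lemma unshuffle_head s : exists2 r, unshuffle s = (s, [::]) :: r &
  all (fun p => (size p.1 < size s)%N) r.
Proof.
elim: s => [|x s [r sE lt_r]] /=; first by exists [::].
exists ([seq (x :: p.1, p.2) | p <- r] ++ [seq (p.1, x :: p.2) | p <- unshuffle
  s]).
  by rewrite [in X in X ++ _]sE.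
rewrite all_cat !all_map; apply/andP; split; first exact: sub_all lt_r.
by apply: sub_all (size_unshuffle s) => p /= /eqP <-; rewrite ltnS leq_addr.
Qed.

End Words.

Lemma big_deriv_seq (V : nmodType) (W : zmodType) (d : V -> V) (s : seq V)
    (F : seq V -> W) :
  \sum_(t <- deriv_seq d s) F t = \sum_(i < size s) F (set_nth 0 s i (d s`_i)).
Proof.
elim: s F => [|y s IH] F /=; first by rewrite big_nil big_ord0.
by rewrite big_cons big_map big_ord_recl IH.
Qed.

Lemma eq_big_all (T : Type) (W : nmodType) (a : pred T) (r : seq T)
    (E F : T -> W) :
  all a r -> (forall t, a t -> E t = F t) ->
  \sum_(t <- r) E t = \sum_(t <- r) F t.
Proof.
move=> ar EF; elim: r ar => [|t r IH] /=; first by rewrite !big_nil.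
by case/andP=> /EF tE /IH rE; rewrite !big_cons tE rE.
Qed.

Section SubAdjacent.
Variables (k : fieldType) (g : postLieAlgType k) (U : algType k) (iota : g ->
  U).
Hypothesis U_env : is_enveloping_algebra iota.
Variables (UU : algType k) (tens : U -> U -> UU).
Hypothesis UU_tens : is_tensor_product_algebra tens.
Variable Delta : {lrmorphism U -> UU}.
Hypothesis Delta_gen : forall x : g,
  Delta (iota x) = tens (iota x) 1 + tens 1 (iota x).
Variable ext : U -> U -> U.
Hypothesis ext_rhd : is_rhd_extension iota ext.

Local Notation lift := (tensor_lift tens).
Local Notation word := (word iota).
Local Notation "u |> v" := (ext u v) (at level 40, left associativity).
Local Notation "u ** v" := (subadjacent_mul tens Delta ext u v)
  (at level 40, left associativity).

Let iotaL : linear iota := (enveloping_lie U_env).1.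
Let extB : bilinear_map ext := ext_bilinear ext_rhd.
Let extL u : linear (ext u) := extB.1 u.
Let extR u : linear (ext^~ u) := extB.2 u.
Let tensB : bilinear_map tens := tens_bilinear UU_tens.
Let liftL (W : lmodType k) (f : U -> U -> W) : linear (lift f) :=
  tensor_lift_lin tens f.

(** * Generators acting by derivations *)

Lemma word_nil : word [::] = 1.
Proof. by rewrite /Defs.word big_nil. Qed.

Lemma word_cons x s : word (x :: s) = iota x * word s.
Proof. by rewrite /Defs.word big_cons. Qed.

Lemma ext_word_deriv x s :
  iota x |> word s = \sum_(t <- deriv_seq (rhd x) s) word t.
Proof. by rewrite (ext_gen_word ext_rhd) big_deriv_seq. Qed.

Lemma ext_gen x y : iota x |> iota y = iota (rhd x y).
Proof.
have := ext_word_deriv x [:: y].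
by rewrite /= big_seq1 !word_cons !word_nil !mulr1.
Qed.

(** On words this is the Leibniz formula defining [ext]. Linearity gives it for a generator as left
    factor, then induction for every left factor. *)
Lemma ext_gen_mul x u v :
  iota x |> (u * v) = (iota x |> u) * v + u * (iota x |> v).
Proof.
have step y : forall v, iota x |> (iota y * v) =
    iota (rhd x y) * v + iota y * (iota x |> v).
  apply: (env_ext U_env) => [||s].
  - exact: lin_comp (extL _) (mull_lin _).
  - by apply: lin_add (mull_lin _) (lin_comp (mull_lin _) (extL _)).
  rewrite -word_cons !ext_word_deriv /= big_cons big_map word_cons mulr_sumr.
  by congr (_ + _); apply: eq_bigr => t _; rewrite word_cons.
elim/(env_ind U_env): u v => [|y u IH|a u u' IH IH'] v.
- by rewrite (ext_gen1 ext_rhd) mul0r add0r !mul1r.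
- by rewrite -mulrA !step IH mulrDr mulrDl !mulrA addrA.
- rewrite mulrDl -scalerAl !extL IH IH' !mulrDl -!scalerAl scalerDr.
  by rewrite addrACA.
Qed.

Lemma ext_mul_gen x u v :
  (iota x * u) |> v = iota x |> (u |> v) - (iota x |> u) |> v.
Proof.
move: u; apply: (env_ext U_env) => [||s].
- exact: lin_comp (extR _) (mull_lin _).
- by apply: lin_sub; [apply: lin_comp (extL _) (extR _)|apply: lin_comp (extR _)
  (extL _)].
- by rewrite -word_cons (ext_word ext_rhd).
Qed.

(* The recursion pattern of the post-Lie product: [iota x |> u] has the same
   length as [u]. *)
Lemma rhd_ext (W : lmodType k) (f h : U -> W) : linear f -> linear h ->
  f 1 = h 1 ->
  (forall x u, f u = h u -> f (iota x |> u) = h (iota x |> u) ->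
    f (iota x * u) = h (iota x * u)) ->
  f =1 h.
Proof.
move=> fL hL fh1 fhM; apply: (env_ext U_env) => // s.
have [n] := ubnP (size s); elim: n s => // n IH [|x s];
  first by rewrite word_nil.
rewrite ltnS => lt_s; rewrite word_cons; apply: fhM; first exact: IH.
rewrite ext_word_deriv (lin_sum fL) (lin_sum hL).
by apply: eq_big_all (size_deriv_seq _ s) _ => t /eqP st; rewrite IH // st.
Qed.

Let mulextB w : bilinear_map (fun a b => a * (b |> w)).
Proof. exact: (bil_comp (bil_mul U) (@lin_id _ _) (extR w)). Qed.

(** * The sub-adjacent product *)

Lemma subadjE u w : u ** w = lift (fun a b => a * (b |> w)) (Delta u).
Proof. by []. Qed.

Lemma subadj_bil : bilinear_map (subadjacent_mul tens Delta ext).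
Proof.
split=> [u|w]; last by apply: lin_comp (liftL _) _; apply: linearP.
move=> a v w; rewrite !subadjE; move: (Delta u);
  apply: (tens_ext UU_tens) => //.
  apply: lin_add => // b t t'; rewrite liftL scalerDr !scalerA.
  by rewrite mulrC.
move=> b c; rewrite !(tensor_liftE UU_tens) //.
by rewrite extL mulrDr scalerAr.
Qed.

Let subL u : linear (subadjacent_mul tens Delta ext u) := subadj_bil.1 u.
Let subR u : linear (fun v => v ** u) := subadj_bil.2 u.

Lemma Delta_gen_mul x u :
  Delta (iota x * u) = (tens (iota x) 1 + tens 1 (iota x)) * Delta u.
Proof. by rewrite rmorphM /= Delta_gen. Qed.

Lemma gen2_mul x a b : (tens (iota x) 1 + tens 1 (iota x)) * tens a b =
  tens (iota x * a) b + tens a (iota x * b).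
Proof. by rewrite mulrDl !(tens_mul UU_tens) !mul1r. Qed.

(* [x |> -] acting diagonally on the tensor square. *)
Definition ext2 x : UU -> UU :=
  lift (fun a b => tens (iota x |> a) b + tens a (iota x |> b)).

Let ext2L x : linear (ext2 x) := liftL _.

Let ext2B x :
  bilinear_map (fun a b => tens (iota x |> a) b + tens a (iota x |> b)).
Proof.
by apply: bil_add; apply: (bil_comp tensB) => //; apply: extL.
Qed.

Lemma ext2E x a b :
  ext2 x (tens a b) = tens (iota x |> a) b + tens a (iota x |> b).
Proof. exact: (tensor_liftE UU_tens). Qed.

Lemma ext2_mul x t t' : ext2 x (t * t') = ext2 x t * t' + t * ext2 x t'.
Proof.
move: t; apply: (tens_ext UU_tens) => [||a b].
- exact: lin_comp (liftL _) (mulr_lin _).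
- exact: lin_add (lin_comp (mulr_lin _) (liftL _)) (mulr_lin _).
move: t'; apply: (tens_ext UU_tens) => [||c d].
- exact: lin_comp (liftL _) (mull_lin _).
- exact: lin_add (mull_lin _) (lin_comp (mull_lin _) (liftL _)).
rewrite (tens_mul UU_tens) !ext2E mulrDl mulrDr !(tens_mul UU_tens)
  !ext_gen_mul.
by rewrite (linD (tensB.1 _)) (linD (tensB.2 _)) addrACA.
Qed.

Lemma tens0 u : tens u 0 = 0.
Proof. exact: lin0 (tensB.1 _). Qed.

Lemma tens0l u : tens 0 u = 0.
Proof. exact: (lin0 (tensB.2 _)). Qed.

Lemma Delta_ext x u : Delta (iota x |> u) = ext2 x (Delta u).
Proof.
elim/(env_ind U_env): u => [|y u IH|a u v IHu IHv].
- rewrite (ext_gen1 ext_rhd) rmorph0 rmorph1 -(tens_one UU_tens) ext2E.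
  by rewrite (ext_gen1 ext_rhd) tens0 tens0l addr0.
- rewrite ext_gen_mul ext_gen rmorphD !rmorphM /= IH ext2_mul;
  congr (_ * _ + _).
  rewrite !Delta_gen (linD (ext2L x)) !ext2E (ext_gen1 ext_rhd).
  by rewrite ext_gen tens0 tens0l addr0 add0r.
- by rewrite extL !linearP /= IHu IHv ext2L.
Qed.

Lemma sub_gen x v : iota x ** v = iota x * v + iota x |> v.
Proof.
rewrite subadjE Delta_gen (linD (liftL _)) !(tensor_liftE UU_tens) //.
by rewrite (ext_1 ext_rhd) mul1r.
Qed.

Lemma sub1u v : 1 ** v = v.
Proof.
rewrite subadjE rmorph1 -(tens_one UU_tens) (tensor_liftE UU_tens) //.
by rewrite (ext_1 ext_rhd) mul1r.
Qed.

(** This is associativity with a generator on the left, as [x u = x ** u - x |> u]. On a pure tensor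
    [tens a b], one term of the Leibniz rule cancels; the other combines into the action of
    [x b]. *)
Lemma sub_mul_gen x u w :
  (iota x * u) ** w = iota x ** (u ** w) - (iota x |> u) ** w.
Proof.
rewrite sub_gen !subadjE Delta_gen_mul Delta_ext.
move: (Delta u); apply: (tens_ext UU_tens) => [||a b].
- exact: lin_comp (liftL _) (mull_lin _).
- apply: lin_sub; last exact: lin_comp (liftL _) (liftL _).
  by apply: lin_add; [apply: lin_comp (mull_lin _) _|apply: lin_comp (extL _)
    _].
rewrite gen2_mul ext2E !(linD (liftL _)) !(tensor_liftE UU_tens) //.
rewrite ext_gen_mul ext_mul_gen mulrBr mulrA opprD.
by rewrite [X in _ + X + _]addrC !addrA addrK.
Qed.

Lemma subA v u w : (v ** u) ** w = v ** (u ** w).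
Proof.
move: v; apply: rhd_ext => [|||x v IH IH'].
- exact: lin_comp (subR _) (subR _).
- exact: subR.
- by rewrite !sub1u.
rewrite !sub_mul_gen (linB (subR _)) IH' -IH; congr (_ - _).
by rewrite !sub_gen (linD (subR _)) sub_mul_gen sub_gen subrK.
Qed.

Lemma subu1 u : u ** 1 = u.
Proof.
move: u; apply: rhd_ext => [|||x u IH IH'] //.
  by rewrite sub1u.
by rewrite sub_mul_gen IH IH' sub_gen addrK.
Qed.

(** The product [**] makes [|>] an action: [x ** u] is [x u + x |> u], and the second term undoes
    the correction in the recursion of [ext]. *)
Lemma ext_sub v u w : (v ** u) |> w = v |> (u |> w).
Proof.
move: v; apply: rhd_ext => [|||x v IH IH'] //.
- exact: lin_comp (extR _) (subR _).
- by rewrite sub1u (ext_1 ext_rhd).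
rewrite sub_mul_gen (linB (extR _)) IH' sub_gen (linD (extR _)) !ext_mul_gen IH.
by rewrite subrK.
Qed.

Lemma Delta_word s :
  Delta (word s) = \sum_(p <- unshuffle s) tens (word p.1) (word p.2).
Proof.
elim: s => [|x s IH].
  by rewrite /= big_seq1 !word_nil rmorph1 (tens_one UU_tens).
rewrite word_cons Delta_gen_mul IH mulr_sumr /= big_cat !big_map /= -big_split
  /=.
by apply: eq_bigr => p _; rewrite gen2_mul !word_cons.
Qed.

Lemma lift_word (W : lmodType k) (f : U -> U -> W) s : bilinear_map f ->
  lift f (Delta (word s)) = \sum_(p <- unshuffle s) f (word p.1) (word p.2).
Proof.
move=> fB; rewrite Delta_word (lin_sum (liftL _)).
by apply: eq_bigr => p _; rewrite (tensor_liftE UU_tens).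
Qed.

(* Left cancellation by the identity in the convolution algebra. *)
Lemma conv_id_eq0 (E : U -> U) : linear E ->
  (forall u, lift (fun a b => E a ** b) (Delta u) = 0) -> forall u, E u = 0.
Proof.
move=> EL E0; apply: (env_ext U_env) => // [|s]; first exact: (@lin_zero k U U).
have [n] := ubnP (size s); elim: n s => // n IH s; rewrite ltnS => le_s.
have := E0 (word s); rewrite lift_word; last first.
  exact: (bil_comp subadj_bil EL (@lin_id _ _)).
(* The head term is [E u ** 1], that is [E u]; the others vanish by induction. *)
have [r -> lt_r] := unshuffle_head s; rewrite big_cons /= word_nil subu1.
rewrite (eq_big_all lt_r (F := fun _ => 0)) ?big1_eq ?addr0 // => p lt_p.
by rewrite IH ?(lin0 (subR _)) // (leq_trans lt_p).
Qed.

(** * The antipode and its compatibility with the coproduct *)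

Variable eps : {lrmorphism U -> k^o}.
Hypothesis eps_gen : forall x : g, eps (iota x) = 0.
Variable S : U -> U.
Hypothesis S_antipode :
  is_antipode tens (subadjacent_mul tens Delta ext) 1 Delta eps S.

Let SL : linear S. Proof. by case: S_antipode. Qed.

Lemma eps_ext x u : eps (iota x |> u) = 0.
Proof.
elim/(env_ind U_env): u => [|y u IH|a u v IHu IHv].
- by rewrite (ext_gen1 ext_rhd) rmorph0.
- by rewrite ext_gen_mul ext_gen rmorphD !rmorphM /= !eps_gen !mul0r addr0.
- by rewrite extL linearP /= IHu IHv scaler0 addr0.
Qed.

Lemma S_1 : S 1 = 1.
Proof.
have [_ /(_ 1) + _] := S_antipode; rewrite !rmorph1 scale1r.
rewrite -(tens_one UU_tens) (tensor_liftE UU_tens) ?subu1 //.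
exact: (bil_comp subadj_bil SL (@lin_id _ _)).
Qed.

(* Both sides agree after convolution with the identity, because the left
   convolution inverse property holds at [iota x * u] and at [iota x |> u]. *)
Lemma S_gen_mul x u : S (iota x * u) = - (S u ** iota x) - S (iota x |> u).
Proof.
have [_ SV _] := S_antipode.
pose E u := S (iota x * u) + S u ** iota x + S (iota x |> u).
suff E0 : E u = 0.
  by apply/eqP; rewrite -subr_eq0 opprB opprK [X in _ + X]addrC addrA -/(E u)
    E0.
have FB : bilinear_map (fun a b => S a ** b).
  exact: (bil_comp subadj_bil SL (@lin_id _ _)).
have EL : linear E.
  apply: lin_add; last exact: lin_comp SL (extL _).
  apply: lin_add; first exact: lin_comp SL (mull_lin _).
  exact: lin_comp (subR _) SL.
apply: conv_id_eq0 => // {}u.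
(* Zero is the sum of the antipode identities at [x u] and at [x |> u]; expanding both coproducts
   gives the convolution of [E] with the identity. *)
have <- : lift (fun a b => S a ** b) (Delta (iota x * u)) +
          lift (fun a b => S a ** b) (Delta (iota x |> u)) = 0.
  by rewrite !SV eps_ext rmorphM /= eps_gen mul0r !scale0r addr0.
rewrite Delta_gen_mul Delta_ext.
move: (Delta u); apply: (tens_ext UU_tens) => [||a b] //.
  by apply: lin_add; apply: lin_comp (liftL _) _;
    [apply: mull_lin|apply: liftL].
rewrite gen2_mul ext2E !(linD (liftL _)) !(tensor_liftE UU_tens) //; last first.
  exact: (bil_comp subadj_bil EL (@lin_id _ _)).
rewrite /E !(linD (subR _)) subA sub_gen (linD (subL _)) addrACA.
by rewrite addrAC.
Qed.

Lemma mul_gen x v : iota x * v = iota x ** v - iota x |> v.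
Proof. by rewrite sub_gen addrK. Qed.

Lemma gen2_sub x a b :
  (tens (iota x) 1 + tens 1 (iota x)) * tens a b + ext2 x (tens a b) =
  tens (iota x ** a) b + tens a (iota x ** b).
Proof.
by rewrite gen2_mul ext2E !sub_gen (linD (tensB.1 _)) (linD (tensB.2 _))
  addrACA.
Qed.

(** Left multiplications by generators act diagonally on the coproduct by [gen2_sub] and commute
    with right multiplication by [x]; at 1 the claim is that [x] is primitive. *)
Lemma Delta_sub_gen u x : Delta (u ** iota x) =
  lift (fun a b => tens (a ** iota x) b + tens a (b ** iota x)) (Delta u).
Proof.
have xB : bilinear_map (fun a b => tens (a ** iota x) b + tens a (b ** iota x)).
  by apply: bil_add; apply: (bil_comp tensB) => //; apply: subR.
move: u; apply: rhd_ext => [|||y u IH IH'].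
- by apply: lin_comp (subR _); apply: linearP.
- by apply: lin_comp (liftL _) _; apply: linearP.
- by rewrite sub1u rmorph1 -(tens_one UU_tens) (tensor_liftE UU_tens) // !sub1u
  Delta_gen.
rewrite sub_mul_gen rmorphB /= IH' sub_gen rmorphD /= !Delta_gen_mul !Delta_ext
  IH.
move: (Delta u); apply: (tens_ext UU_tens) => [||a b].
- apply: lin_sub; last exact: lin_comp (liftL _) (ext2L _).
  by apply: lin_add; [apply: lin_comp (mull_lin _) _|apply: lin_comp (ext2L _)
    _].
- exact: lin_comp (liftL _) (mull_lin _).
rewrite gen2_mul ext2E !(linD (liftL _)) !(tensor_liftE UU_tens) //.
rewrite mulrDr (linD (ext2L _)) addrACA !gen2_sub !sub_mul_gen !mul_gen.
rewrite !(linB (tensB.1 _)) !(linB (tensB.2 _)).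
by rewrite [X in X - _]addrACA opprD [LHS]addrACA !opprD; congr (_ + _);
  rewrite [LHS]addrACA.
Qed.

(** No flip appears, [Delta] being cocommutative. The recursion [S_gen_mul] carries the claim from
    [u] and [x |> u] to [x u]. *)
Lemma Delta_S u : Delta (S u) = lift (fun a b => tens (S a) (S b)) (Delta u).
Proof.
have SB : bilinear_map (fun a b => tens (S a) (S b)) by exact: (bil_comp tensB).
move: u; apply: rhd_ext => [|||x u IH IH'].
- by apply: lin_comp SL; apply: linearP.
- by apply: lin_comp (liftL _) _; apply: linearP.
- by rewrite S_1 rmorph1 -(tens_one UU_tens) (tensor_liftE UU_tens) // !S_1.
rewrite S_gen_mul rmorphB rmorphN /= IH' Delta_sub_gen IH Delta_ext
  Delta_gen_mul.
have xB : bilinear_map (fun a b => tens (a ** iota x) b + tens a (b ** iota x)).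
  by apply: bil_add; apply: (bil_comp tensB) => //; apply: subR.
move: (Delta u); apply: (tens_ext UU_tens) => [||a b].
- apply: lin_sub; last exact: lin_comp (liftL _) (ext2L _).
  by apply: lin_opp; apply: lin_comp (liftL _) (liftL _).
- exact: lin_comp (liftL _) (mull_lin _).
rewrite gen2_mul ext2E !(linD (liftL _)) !(tensor_liftE UU_tens) // !S_gen_mul.
rewrite !(linB (tensB.1 _)) !(linB (tensB.2 _)) (linN (tensB.1 _)) (linN
  (tensB.2 _)).
by rewrite !opprD [LHS]addrACA.
Qed.

(** * The antipode on words, from an abstract bracket given by its recursion *)

Variable br : seq g -> g -> g.
Hypothesis br_nil : forall y, br [::] y = y.
Hypothesis br_cons : forall x s y,
  br (x :: s) y = br s (rhd x y) + \sum_(t <- deriv_seq (rhd x) s) br t y.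

(** By [ext_sub], [S u ** x] acts on [y] as [S u] acts on [x |> y]; so [S_gen_mul] turns into the
    recursion of [br]. *)
Lemma S_word_ext s y :
  S (word s) |> iota y = (-1) ^+ size s *: iota (br s y).
Proof.
have [n] := ubnP (size s); elim: n s y => // n IH [|x s] y.
  by rewrite word_nil S_1 (ext_1 ext_rhd) br_nil scale1r.
rewrite ltnS => lt_s; rewrite word_cons S_gen_mul (linB (extR _)) (linN (extR
  _)).
rewrite ext_sub ext_gen IH // br_cons (linD iotaL) (lin_sum iotaL)
  ext_word_deriv.
rewrite (lin_sum SL) (lin_sum (extR _)) exprS mulN1r scaleNr scalerDr opprD.
congr (_ - _); rewrite scaler_sumr; apply: eq_big_all (size_deriv_seq _ s) _ =>
  t /eqP st.
by rewrite IH ?st.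
Qed.

Lemma S_word (T : seq g -> U) : T [::] = 1 ->
  (forall x s, T (x :: s) =
     \sum_(p <- unshuffle s) T p.1 * iota (br p.2 x) +
     \sum_(t <- deriv_seq (rhd x) s) T t) ->
  forall s, S (word s) = (-1) ^+ size s *: T s.
Proof.
move=> T0 T_cons s.
have [n] := ubnP (size s); elim: n s => // n IH [|x s].
  by rewrite word_nil S_1 T0 scale1r.
rewrite ltnS => lt_s; rewrite word_cons S_gen_mul T_cons [size _]/= exprS mulN1r
  scaleNr.
rewrite scalerDr opprD; congr (_ + _); congr (- _); last first.
  rewrite ext_word_deriv (lin_sum SL) scaler_sumr.
  by apply: eq_big_all (size_deriv_seq _ s) _ => t /eqP st; rewrite IH ?st.
(* The second coproduct factor acts on [x] and gives a bracket by [S_word_ext]; the two signs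
   multiply to that of [s], as the lengths add up. *)
rewrite subadjE Delta_S.
have SB : bilinear_map (fun a b => tens (S a) (S b)) by exact: (bil_comp tensB).
have hB := mulextB (iota x).
rewrite Delta_word (lin_sum (liftL _)) (lin_sum (liftL _)) scaler_sumr.
apply: eq_big_all (size_unshuffle s) _ => p /eqP sp.
rewrite !(tensor_liftE UU_tens) // S_word_ext IH; last first.
  by apply: (@leq_ltn_trans (size s)) => //; rewrite -sp leq_addr.
by rewrite -scalerAl -scalerAr scalerA -exprD sp.
Qed.

End SubAdjacent.

(** * Brackets *)

(** Used to insert a symbol at position [j]: [lift j] numbers the remaining positions. *)
Lemma enum_ord_lift r (j : 'I_r.+1) :
  enum 'I_r.+1 = [seq lift j i | i <- take j (enum 'I_r)] ++
                 j :: [seq lift j i | i <- drop j (enum 'I_r)].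
Proof.
have le_jr : (j <= r)%N by rewrite -ltnS.
apply: (inj_map val_inj); rewrite val_enum_ord map_cat map_cons -!map_comp.
rewrite (eq_map (g := bump j \o val)) // (eq_map (f := val \o _) (g := bump j \o
  val)) //.
rewrite !map_comp map_take map_drop val_enum_ord take_iota drop_iota (minn_idPl
  le_jr).
have -> : [seq bump j i | i <- seq.iota 0 j] = seq.iota 0 j.
  apply: map_id_in => i; rewrite mem_iota /= add0n => lt_ij.
  by rewrite /bump leqNgt lt_ij.
have -> : [seq bump j i | i <- seq.iota (0 + j) (r - j)] = seq.iota j.+1 (r -
  j).
  rewrite add0n -[j.+1]add1n iotaDl; apply/eq_in_map => i;
    rewrite mem_iota => /andP[le_ji _].
  by rewrite /bump le_ji.
transitivity (seq.iota 0 (j + (r - j).+1)); first by rewrite addnS subnKC.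
by rewrite iotaD.
Qed.

Section BracketRecursion.
Variables (k : fieldType) (g : postLieAlgType k).

Lemma merge_at_cat r (p t : seq (seq 'I_r * g)) i :
  all (fun A => i \notin A.1) p -> merge_at (p ++ t) i = p ++ merge_at t i.
Proof.
elim: p => //= A p IH /andP[/negPf iA ip]; rewrite iA IH //.
by case: p ip IH => //=; case: t.
Qed.

(** Once symbol 0 has been merged, dropping its index and lowering the others leaves a state of the
    process for [r] symbols. *)
Definition unlift_entry r (A : seq 'I_r.+1 * g) : seq 'I_r * g :=
  (pmap (unlift ord0) A.1, A.2).

Lemma mem_pmap_unlift r (l : seq 'I_r.+1) i :
  (i \in pmap (unlift ord0) l) = (lift ord0 i \in l).
Proof.
elim: l => //= a l IH; rewrite in_cons -IH.
by case: unliftP => [b ->|->] /=; rewrite ?in_cons ?(inj_eq lift_inj) // eq_sym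
  (negPf (neq_lift _ _)).
Qed.

Lemma merge_at_unlift r (s : seq (seq 'I_r.+1 * g)) i :
  merge_at (map (@unlift_entry r) s) i =
  map (@unlift_entry r) (merge_at s (lift ord0 i)).
Proof.
elim: s => //= A [|C t] //= IH; rewrite mem_pmap_unlift; case: ifP => //= _.
  by rewrite /unlift_entry /= pmap_cat.
by rewrite -IH.
Qed.

Lemma foldl_merge_unlift r (l : seq 'I_r) (s : seq (seq 'I_r.+1 * g)) :
  foldl (@merge_at k g r) (map (@unlift_entry r) s) l =
  map (@unlift_entry r) (foldl (@merge_at k g r.+1) s (map (lift ord0) l)).
Proof. by elim: l s => //= i l IH s; rewrite merge_at_unlift IH. Qed.

Lemma head_foldl_merge r (d d' : seq 'I_r * g) (l : seq 'I_r) s : s != [::] ->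
  head d (foldl (@merge_at k g r) s l) = head d' (foldl (@merge_at k g r) s l).
Proof.
elim: l s => [|i l IH] [|A s] //= _; apply: IH.
by case: s => // C s; case: ifP.
Qed.

(** [lift_perm j ord0 w] puts [x], the symbol of index 0, at position [j] and the others in the
    order [w]. The first merge absorbs [x] into its right neighbour [C]. *)
Lemma perm_bracket_lift r (x : g) (s : seq g) y (j : 'I_r.+1) (w : 'S_r) C t :
  rcons [seq ([:: w i], s`_(w i)) | i <- drop j (enum 'I_r)] ([::], y) = C :: t
    ->
  perm_bracket (fun i : 'I_r.+1 => (x :: s)`_i) y (lift_perm j ord0 w) =
  (head ([::], y)
     (foldl (@merge_at k g r)
        ([seq ([:: w i], s`_(w i)) | i <- take j (enum 'I_r)] ++
         (C.1, rhd x C.2) :: t)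
        (enum 'I_r))).2.
Proof.
move=> tE; rewrite /perm_bracket {2}enum_ordSl.
set l := map _ (enum 'I_r); rewrite (enum_ord_lift j) map_cat map_cons
  -!map_comp.
rewrite rcons_cat /= lift_perm_id merge_at_cat; last first.
  rewrite all_map; apply/allP => i _; rewrite /= lift_perm_lift mem_seq1.
  exact: neq_lift.
set start := _ ++ _.
suff -> : [seq ([:: w i], s`_(w i)) | i <- take j (enum 'I_r)] ++
    (C.1, rhd x C.2) :: t = map (@unlift_entry r) start.
  by rewrite foldl_merge_unlift -/l; case: (foldl _ start _).
rewrite /start map_cat -map_comp; congr (_ ++ _).
  by apply: eq_map => i; rewrite /= lift_perm_lift /unlift_entry /= liftK.
move: tE; rewrite {}/start.
(* The neighbour is [y] if [j] is the last position, and otherwise the symbol that follows. *)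
case: (drop j _) => [|i d] /= [<- <-]; rewrite /unlift_entry /=.
  by rewrite unlift_none.
rewrite unlift_none lift_perm_lift liftK map_rcons -map_comp;
  congr (_ :: rcons _ _).
by apply: eq_map => i'; rewrite /= lift_perm_lift /= liftK.
Qed.

(** The number of letters is a separate parameter, so that changing a letter of [s] keeps the index
    type of the sum. *)
Definition bracket r (s : seq g) (y : g) : g :=
  \sum_(w : 'S_r) perm_bracket (fun i : 'I_r => s`_i) y w.

Lemma set_bracketE m (x : 'I_m -> g) (I : {set 'I_m}) y :
  set_bracket x I y = bracket #|I| [seq x i | i <- enum I] y.
Proof.
rewrite /set_bracket /bracket; apply: eq_bigr => w _; congr perm_bracket.
apply/funext => j; rewrite (enum_val_nth (enum_val j)) (nth_map (enum_val j))
  //.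
by rewrite -cardE.
Qed.

Lemma bracket_nil s y : bracket 0 s y = y.
Proof.
rewrite /bracket (big_pred1 1%g) => [|w].
  by rewrite /perm_bracket enum_ord0.
by rewrite /= (_ : w = 1%g) ?eqxx //; apply/permP => -[].
Qed.

(** A permutation is given by the position of 0 and the order of the rest; injectivity suffices, as
    (r+1)! = (r+1) r!. *)
Lemma lift_perm0_bij r :
  bijective (fun p : 'I_r.+1 * 'S_r => lift_perm p.1 ord0 p.2).
Proof.
apply: inj_card_bij => [[i v] [j w] /= E|]; last first.
  by rewrite card_prod !card_Sn card_ord factS.
have ij : i = j by apply: (@perm_inj _ (lift_perm j ord0 w));
  rewrite -{1}E !lift_perm_id.
congr (_, _) => //; move: E; rewrite ij => E; apply/permP => l.
by apply: (@lift_inj _ ord0); rewrite -!(lift_perm_lift j) E.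
Qed.

Lemma perm_bracket_lift_max r x (s : seq g) y (w : 'S_r) :
  perm_bracket (fun i : 'I_r.+1 => (x :: s)`_i) y (lift_perm ord_max ord0 w) =
  perm_bracket (fun i : 'I_r => s`_i) (rhd x y) w.
Proof.
have sz : size (enum 'I_r) = r by rewrite size_enum_ord.
rewrite (perm_bracket_lift x (C := ([::], y)) (t := [::])) ?drop_oversize ?sz
  //.
rewrite take_oversize ?sz // cats1 /perm_bracket.
congr _.2; apply: head_foldl_merge.
by case: (map _ _).
Qed.

Lemma perm_bracket_lift_lt r x (s : seq g) y (j : 'I_r) (w : 'S_r) :
  perm_bracket (fun i : 'I_r.+1 => (x :: s)`_i) y
    (lift_perm (widen_ord (leqnSn r) j) ord0 w) =
  perm_bracket (fun i : 'I_r => (set_nth 0 s (w j) (rhd x s`_(w j)))`_i) y w.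
Proof.
have sz : size (enum 'I_r) = r by rewrite size_enum_ord.
have e := enum_uniq 'I_r.
rewrite (perm_bracket_lift x (C := ([:: w j], s`_(w j)))
  (t := rcons [seq ([:: w i], s`_(w i)) | i <- drop j.+1 (enum 'I_r)] ([::],
    y))).
  2: by rewrite [X in drop X _]/= (drop_nth j) ?sz // nth_ord_enum.
have eE : enum 'I_r = take j (enum 'I_r) ++ j :: drop j.+1 (enum 'I_r).
  by rewrite -[LHS](cat_take_drop j) (@drop_nth _ j j) ?sz // nth_ord_enum.
rewrite [X in take X _]/= /perm_bracket.
rewrite [X in _ = (head _ (foldl _ (rcons (map _ X) _) _)).2]eE.
rewrite map_cat map_cons rcons_cat rcons_cons nth_set_nth [in RHS]/= eqxx.
have E i : i != j -> (set_nth 0 s (w j) (rhd x s`_(w j)))`_(w i) = s`_(w i).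
  by move=> ij; rewrite nth_set_nth /= (inj_eq val_inj) (inj_eq perm_inj) (negPf
    ij).
rewrite eE cat_uniq /= negb_or in e; have /and3P[_ /andP[jt _] /andP[jd _]] :=
  e.
congr (head _ (foldl _ (_ ++ _ :: rcons _ _) _)).2.
  by apply/eq_in_map => i it; rewrite E //; apply: contraTneq it => ->.
by apply/eq_in_map => i it; rewrite E //; apply: contraTneq it => ->.
Qed.

(* Step 1 of the merging process attaches [x] to its right neighbour, which is
   [y] or any entry of [s]; deleting [x] from the permutation [w] leaves an
   arbitrary permutation of the other indices. *)
Lemma bracket_cons r x (s : seq g) y :
  bracket r.+1 (x :: s) y = bracket r s (rhd x y) +
    \sum_(i < r) bracket r (set_nth 0 s i (rhd x s`_i)) y.
Proof.
rewrite {1}/bracket (reindex _ (onW_bij _ (lift_perm0_bij r))) /=.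
rewrite -(pair_bigA _ (fun j w => perm_bracket (fun i : 'I_r.+1 => (x :: s)`_i)
  y
                                  (lift_perm j ord0 w))) /=.
rewrite big_ord_recr /= addrC; congr (_ + _).
  by apply: eq_bigr => w _; apply: perm_bracket_lift_max.
rewrite exchange_big [RHS]exchange_big; apply: eq_bigr => w _ /=.
(* The letter changed has index [w j], which runs through all letters with [j]. *)
rewrite [RHS](reindex_inj (@perm_inj _ w)); apply: eq_bigr => j _ /=.
exact: perm_bracket_lift_lt.
Qed.

End BracketRecursion.

(** * Sums over partitions *)

Section Distributions.
Variable T : Type.
Implicit Types (p : nat -> seq T) (s : seq T).

(** Families of blocks are functions on all of [nat], so that their number can change without a
    change of type. *)
Definition update p j s : nat -> seq T := fun i => if i == j then s else p i.

Definition cons_at x j p : nat -> seq T := update p j (x :: p j).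

(* Sum of [F p] over the ways to distribute the entries of [s] into
   subsequences [p 0, .., p (N - 1)]; the other [p i] are empty. *)
Fixpoint distr (W : nmodType) N s (F : (nat -> seq T) -> W) : W :=
  if s is x :: s' then \sum_(j < N) distr N s' (fun p => F (cons_at x j p))
  else F (fun _ => [::]).

Lemma cons_atE x j p i : cons_at x j p i = if i == j then x :: p j else p i.
Proof. by []. Qed.

Lemma update_cons_at x i j s p : i != j ->
  update (cons_at x j p) i s = cons_at x j (update p i s).
Proof.
move=> ij; apply/funext => l; rewrite /cons_at /update [j == i]eq_sym (negPf
  ij).
by case: eqVneq => // ->; rewrite (negPf ij).
Qed.

Lemma update_cons_at_same x j s p :
  update (cons_at x j p) j s = update p j s.
Proof. by apply/funext => l; rewrite /cons_at /update; case: eqP. Qed.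

Lemma cons_at_update_same x j s p :
  cons_at x j (update p j s) = update p j (x :: s).
Proof. by apply/funext => l; rewrite /cons_at /update eqxx; case: eqP. Qed.

Section Sums.
Variables (W : nmodType) (N : nat).

Lemma eq_distr s (F H : (nat -> seq T) -> W) :
  (forall p, (forall j, size (p j) <= size s)%N -> F p = H p) ->
  distr N s F = distr N s H.
Proof.
elim: s F H => [|x s IH] F H FH /=; first exact: FH.
apply: eq_bigr => j _; apply: IH => p sp; apply: FH => i.
by rewrite cons_atE; case: eqP => _; rewrite ?ltnS // leqW.
Qed.

Lemma distr0 s : distr N s (fun _ => 0 : W) = 0.
Proof. by elim: s => //= x s IH; apply: big1. Qed.

Lemma distrD s (F H : (nat -> seq T) -> W) :
  distr N s (fun p => F p + H p) = distr N s F + distr N s H.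
Proof.
elim: s F H => //= x s IH F H; rewrite -big_split; apply: eq_bigr => j _ /=.
exact: (IH (fun p => F (cons_at x j p)) (fun p => H (cons_at x j p))).
Qed.

Lemma distr_sum I (r : seq I) s (F : I -> (nat -> seq T) -> W) :
  distr N s (fun p => \sum_(i <- r) F i p) = \sum_(i <- r) distr N s (F i).
Proof.
elim: r => [|i r IH].
  by rewrite big_nil -[RHS](distr0 s); apply: eq_distr => p _; rewrite big_nil.
rewrite big_cons -IH -distrD; apply: eq_distr => p _; exact: big_cons.
Qed.

(* A Leibniz rule: every entry of [s] lies in exactly one [p j]. *)
Lemma distr_deriv (d : T -> T) s (F : (nat -> seq T) -> W) :
  \sum_(t <- deriv_seq d s) distr N t F =
  distr N s (fun p => \sum_(j < N) \sum_(t <- deriv_seq d (p j))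
    F (update p j t)).
Proof.
elim: s F => [|x s IH] F /=.
  by rewrite big_nil big1 // => j _; rewrite big_nil.
rewrite big_cons big_map exchange_big -big_split; apply: eq_bigr => j _ /=.
rewrite IH -distrD; apply: eq_distr => p _.
rewrite [RHS](bigD1 j) // [in LHS](bigD1 j) //= addrA; congr (_ + _).
    rewrite cons_atE eqxx /= big_cons big_map update_cons_at_same.
  congr (_ + _); apply: eq_bigr => t _.
  by rewrite update_cons_at_same cons_at_update_same.
apply: eq_bigr => i ij; rewrite cons_atE (inj_eq val_inj) (negPf ij).
by apply: eq_bigr => t _; rewrite update_cons_at.
Qed.

(* Choose first the subsequence labelled [N], then distribute the rest. *)
Lemma distr_recr s (F : (nat -> seq T) -> W) :
  distr N.+1 s F =
  \sum_(q <- unshuffle s) distr N q.1 (fun p => F (update p N q.2)).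
Proof.
elim: s F => [|x s IH] F /=.
  by rewrite big_seq1; congr F; apply/funext => i; rewrite /update if_same.
rewrite big_ord_recr big_cat !big_map /= IH; congr (_ + _).
  under eq_bigr do rewrite IH.
  rewrite exchange_big; apply: eq_bigr => q _; apply: eq_bigr => j _.
  apply: eq_distr => p _; rewrite update_cons_at // neq_ltn.
  by rewrite ltn_ord orbT.
by apply: eq_bigr => q _; apply: eq_distr => p _; rewrite cons_at_update_same.
Qed.

End Sums.

Lemma distr_mulr (A : pzSemiRingType) N s (F : (nat -> seq T) -> A) c :
  distr N s (fun p => F p * c) = distr N s F * c.
Proof.
elim: s F => //= x s IH F; rewrite mulr_suml; apply: eq_bigr => j _.
exact: (IH (fun p => F (cons_at x j p))).
Qed.

(** A distribution of letters is a labelling of their indices; splitting off the label of index 0 is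
    one step of [distr]. *)
Lemma distr_ffun (W : nmodType) N m (x : 'I_m -> T) (F : (nat -> seq T) -> W) :
  \sum_(f : {ffun 'I_m -> 'I_N})
     F (fun j => [seq x i | i <- enum 'I_m & f i == j :> nat]) =
  distr N [seq x i | i <- enum 'I_m] F.
Proof.
elim: m x F => [|m IH] x F.
  rewrite enum_ord0 /= (big_pred1 (ffun0 (card_ord 0))) // => f /=.
  by apply/esym/eqP/ffunP => -[].
pose h (u : 'I_N * {ffun 'I_m -> 'I_N}) : {ffun 'I_m.+1 -> 'I_N} :=
  [ffun i => oapp u.2 u.1 (unlift ord0 i)].
have h_bij : bijective h.
  exists (fun f : {ffun 'I_m.+1 -> 'I_N} => (f ord0, [ffun i => f (lift ord0
    i)])) => [[j f]|f].
    rewrite /h ffunE unlift_none; congr (_, _); apply/ffunP => i.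
    by rewrite !ffunE /= liftK.
  by apply/ffunP => i; rewrite ffunE; case: unliftP => [l|] -> //=;
    rewrite ffunE.
rewrite (reindex _ (onW_bij _ h_bij)) /=.
rewrite -(pair_bigA _ (fun j f => F (fun c => [seq x i | i <- enum 'I_m.+1 & h
  (j, f) i == c :> nat]))) /=.
rewrite enum_ordSl /= -map_comp; apply: eq_bigr => j _.
rewrite -IH; apply: eq_bigr => f _; congr F; apply/funext => c.
rewrite cons_atE /= filter_map ffunE unlift_none /= [c == j]eq_sym.
rewrite (eq_filter (a2 := fun i => f i == c :> nat)); last first.
  by move=> i; rewrite /= ffunE liftK.
by case: eqP => [<-|_] /=; rewrite -map_comp.
Qed.

End Distributions.

(** * The partition sum and its recursion *)

Section PartitionSum.
Variables (k : fieldType) (g : postLieAlgType k) (U : algType k) (iota : g ->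
  U).
Hypothesis iotaL : linear iota.
Implicit Types (s t : seq g) (p : nat -> seq g).

Definition seq_bracket s (y : g) : g := bracket (size s) s y.

Lemma seq_bracket_nil y : seq_bracket [::] y = y.
Proof. exact: bracket_nil. Qed.

Lemma seq_bracket_cons x s y : seq_bracket (x :: s) y =
  seq_bracket s (rhd x y) + \sum_(t <- deriv_seq (rhd x) s) seq_bracket t y.
Proof.
rewrite /seq_bracket /= bracket_cons big_deriv_seq; congr (_ + _).
by apply: eq_bigr => i _; rewrite size_set_nth (maxn_idPr _).
Qed.

(* Block [j] of the partition is [p j.+1], and [p 0] lists the last block. *)
Definition block_term n p : U :=
  if size (p 0) == n then
    \prod_(j < n) iota (seq_bracket (p j.+1) (rev (p 0))`_j)
  else 0.

Definition partition_sum s : U :=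
  \sum_(n < (size s).+1) distr n.+1 s (block_term n).

(** The last block takes [n] letters from [s], so the terms with [n] above [size s] vanish. *)
Lemma partition_sum_wide M s : (size s <= M)%N ->
  \sum_(n < M.+1) distr n.+1 s (block_term n) = partition_sum s.
Proof.
move=> le_sM; rewrite /partition_sum.
rewrite [RHS](big_ord_widen M.+1 (fun n => distr n.+1 s (block_term n))) //.
rewrite [RHS]big_mkcond; apply: eq_bigr => n _; case: ltnP => // lt_sn.
rewrite -[RHS](distr0 U n.+1 s); apply: eq_distr => p sp.
by rewrite /block_term ltn_eqF // (leq_ltn_trans (sp 0)).
Qed.

Lemma partition_sum_nil : partition_sum [::] = 1.
Proof. by rewrite /partition_sum big_ord1 /= /block_term big_ord0. Qed.

(** In a noncommutative algebra a product depends on one factor [v] through [a * v * b], hence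
    additively. *)
Lemma prod_single n (j : 'I_n) (E : 'I_n -> U) : exists a b, forall v,
  \prod_(i < n) (if i == j then v else E i) = a * v * b.
Proof.
elim: n j E => [[] //|n IH] j E.
case: (unliftP ord0 j) => [j'|] ->.
  have [a [b abE]] := IH j' (fun i => E (lift ord0 i)).
  exists (E ord0 * a), b => v; rewrite big_ord_recl /= -!mulrA; congr (_ * _).
  rewrite mulrA -abE; apply: eq_bigr => i _.
  by rewrite (inj_eq lift_inj).
exists 1, (\prod_(i < n) E (lift ord0 i)) => v; rewrite big_ord_recl eqxx mul1r.
by congr (_ * _); apply: eq_bigr => i _; rewrite eq_sym (negPf (neq_lift _ _)).
Qed.

Lemma prod_singleD n (j : 'I_n) (E : 'I_n -> U) u v :
  \prod_(i < n) (if i == j then u + v else E i) =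
  \prod_(i < n) (if i == j then u else E i) +
  \prod_(i < n) (if i == j then v else E i).
Proof.
by have [a [b abE]] := prod_single j E; rewrite !abE mulrDr mulrDl.
Qed.

Lemma prod_single_sum n (j : 'I_n) (E : 'I_n -> U) (I : Type) (r : seq I) (F : I
  -> U) :
  \prod_(i < n) (if i == j then \sum_(t <- r) F t else E i) =
  \sum_(t <- r) \prod_(i < n) (if i == j then F t else E i).
Proof.
have [a [b abE]] := prod_single j E; rewrite abE mulr_sumr mulr_suml.
by apply: eq_bigr => t _; rewrite abE.
Qed.

(** In each factor, the action of [x] on the argument of the bracket and its actions on the letters
    of the block add up, by [seq_bracket_cons], to the insertion of [x] in the block. *)
Lemma block_term_deriv n x p :
  \sum_(j < n.+1) \sum_(t <- deriv_seq (rhd x) (p j)) block_term n (update p j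
    t) =
  \sum_(j < n) block_term n (cons_at x j.+1 p).
Proof.
have [p0|np0] := eqVneq (size (p 0)) n; last first.
  rewrite [RHS]big1 => [|j _]; last first.
    by rewrite /block_term cons_atE /= (negPf np0).
  apply: big1 => j _.
  rewrite (eq_big_all (size_deriv_seq _ _) (F := fun _ => 0)) ?big1_eq // => t
    /eqP st.
  rewrite /block_term /update; case: (0%N =P j :> nat) => [p0|_];
    last by rewrite (negPf np0).
  by rewrite st -p0 (negPf np0).
pose E (i : 'I_n) := iota (seq_bracket (p i.+1) (rev (p 0))`_i).
transitivity (\sum_(j < n) (
    \prod_(i < n) (if i == j then
       iota (seq_bracket (p j.+1) (rhd x (rev (p 0))`_j)) else E i) +
    \sum_(t <- deriv_seq (rhd x) (p j.+1))
      \prod_(i < n) (if i == j then iota (seq_bracket t (rev (p 0))`_j) else E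
        i))).
  rewrite big_ord_recl big_split; congr (_ + _).
    (* The last block is read backwards, so its position [j] belongs to the factor [rev_ord j]. *)
    rewrite big_deriv_seq p0 (reindex_inj rev_ord_inj); apply: eq_bigr => j _.
    have lt_j : (n - j.+1 < n)%N := ltn_ord (rev_ord j).
    rewrite /block_term /update /= size_set_nth p0 (maxn_idPr _) // eqxx.
    apply: eq_bigr => i _; rewrite /E.
    rewrite !nth_rev ?size_set_nth ?p0 ?(maxn_idPr _) // nth_set_nth /=.
    rewrite -[(n - i.+1)%N]/(rev_ord i : nat) -[(n - j.+1)%N]/(rev_ord j : nat).
    by rewrite (inj_eq val_inj) (inj_eq rev_ord_inj); case: eqP => // ->.
  apply: eq_bigr => j _; apply: eq_bigr => t _.
  rewrite /block_term /update /= p0 eqxx; apply: eq_bigr => i _.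
  by rewrite eqSS (inj_eq val_inj); case: eqP => [->|].
apply: eq_bigr => j _; rewrite -prod_single_sum -prod_singleD -lin_sum //.
rewrite -linD // -seq_bracket_cons /block_term cons_atE /= p0 eqxx.
apply: eq_bigr => i _; rewrite cons_atE eqSS (inj_eq val_inj).
by case: eqP => [->|].
Qed.

(** A new first letter comes last when the block is read backwards, so it is the argument of the
    additional factor. *)
Lemma block_term_last n x p :
  block_term n.+1 (cons_at x 0 p) = block_term n p * iota (seq_bracket (p n.+1)
    x).
Proof.
rewrite /block_term cons_atE /= eqSS; case: eqP => [p0|_];
  last by rewrite mul0r.
rewrite big_ord_recr rev_cons; congr (_ * iota (seq_bracket _ _)).
  apply: eq_bigr => i _; rewrite cons_atE /= nth_rcons size_rev p0.
  by rewrite ltn_ord.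
by rewrite nth_rcons size_rev p0 ltnn eqxx.
Qed.

Lemma partition_sum_cons x s : partition_sum (x :: s) =
  \sum_(q <- unshuffle s) partition_sum q.1 * iota (seq_bracket q.2 x) +
  \sum_(t <- deriv_seq (rhd x) s) partition_sum t.
Proof.
(* The sum is split by the label of [x]: 0 for the last block, or that of another block. *)
rewrite {1}/partition_sum; under eq_bigr do rewrite [distr _ _ _]/=
  big_ord_recl.
rewrite big_split; congr (_ + _).
  (* For [n = 0] the last block is empty and cannot contain [x]. *)
  rewrite big_ord_recl /= (eq_distr _ (H := fun _ => 0)) ?distr0 ?add0r => [|p
    _]; last first.
    by rewrite /block_term cons_atE.
  under eq_bigr => n _.
    (* The block of the last factor is chosen first: it is [q.2], and [q.1] is distributed over the
       others. *)
    rewrite /bump /= add1n distr_recr.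
    under eq_bigr => q _.
      rewrite (eq_distr _ (H := fun p => block_term n p * iota (seq_bracket q.2
        x))); last first.
        move=> p _; rewrite block_term_last {2}/update eqxx; congr (_ * _).
        rewrite /block_term /update /=; case: eqP => // _.
        by apply: eq_bigr => i _; rewrite eqSS ltn_eqF.
      rewrite distr_mulr; over.
    over.
  rewrite exchange_big; apply: eq_big_all (size_unshuffle s) _ => q /eqP sq.
  rewrite -mulr_suml; congr (_ * _); apply: partition_sum_wide.
  by rewrite -sq leq_addr.
(* With [x] in another block, [block_term_deriv] and the Leibniz rule [distr_deriv] give the words
   of [x |> s]. *)
transitivity (\sum_(n < (size s).+2) \sum_(t <- deriv_seq (rhd x) s)
    distr n.+1 t (block_term n)).
  apply: eq_bigr => n _; rewrite distr_deriv -distr_sum; apply: eq_distr => p _.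
  by rewrite block_term_deriv.
rewrite exchange_big; apply: eq_big_all (size_deriv_seq _ s) _ => t /eqP st.
by apply: partition_sum_wide; rewrite st.
Qed.

(* [ordS] cyclically shifts the labels, sending the last block to [0]. *)
Lemma partition_termE m n (x : 'I_m -> g) (f : {ffun 'I_m -> 'I_n.+1}) :
  (if #|[set i | f i == ord0]| == n then
     partition_term iota x [ffun j => [set i | f i == ordS j]] else 0) =
  block_term n (fun j => [seq x i | i <- enum 'I_m & f i == j :> nat]).
Proof.
have enumE (c : 'I_n.+1) : enum [set i | f i == c] =
    [seq i <- enum 'I_m | f i == c :> nat].
  by rewrite {1}/enum_mem -enumT; apply: eq_filter => i; rewrite !inE.
rewrite /block_term size_map cardE enumE /=; case: eqP => // sz.
apply: eq_bigr => j _; rewrite !ffunE set_bracketE cardE -(size_map x)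
  -/(seq_bracket _ _).
rewrite -map_rev !enumE /= modnn modn_small // ltnS.
exact: ltn_ord.
Qed.

Lemma sum_is_partition m n (x : 'I_m -> g) :
  \sum_(B : {ffun 'I_n.+1 -> {set 'I_m}} | is_partition B) partition_term iota x
    B =
  distr n.+1 [seq x i | i <- enum 'I_m] (block_term n).
Proof.
pose h (f : {ffun 'I_m -> 'I_n.+1}) : {ffun 'I_n.+1 -> {set 'I_m}} :=
  [ffun j => [set i | f i == ordS j]].
(* An index goes to the shifted label of its block; the default is not reached when the blocks
   cover. *)
pose h' (B : {ffun 'I_n.+1 -> {set 'I_m}}) : {ffun 'I_m -> 'I_n.+1} :=
  [ffun i => ordS (odflt ord0 [pick j | i \in B j])].
have hK f : h' (h f) = f.
  apply/ffunP => i; rewrite ffunE; case: pickP => [j|].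
    by rewrite ffunE inE => /eqP.
  by move/(_ (ord_pred (f i))); rewrite ffunE inE ord_predK eqxx.
have h'K B : is_partition B -> h (h' B) = B.
  case/and3P => /forallP disj /eqP cov _; apply/ffunP => j; apply/setP => i.
  rewrite ffunE inE ffunE (inj_eq (@ordS_inj _)); case: pickP => [l il|i0].
    apply/eqP/idP => [<- //|ij]; apply/eqP/contraT => lj.
    by have /forallP/(_ j) := disj l; rewrite lj => /pred0P/(_ i) /=;
      rewrite il ij.
  by have := in_setT i; rewrite -cov => /bigcupP[l _]; rewrite i0.
have ordS_max : ordS (ord_max : 'I_n.+1) = ord0 by apply: val_inj;
  rewrite /= modnn.
(* The fibres of a labelling are disjoint and cover, so only the size condition remains. *)
have h_part f : is_partition (h f) = (#|[set i | f i == ord0]| == n).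
  rewrite /is_partition ffunE ordS_max; case: (_ == n);
    rewrite ?andbF // !andbT.
  apply/andP; split.
    apply/forallP => i; apply/forallP => j; apply/implyP => ij.
    apply/pred0P => l; rewrite /= !ffunE !inE;
      apply: contra_neqF ij => /andP[/eqP -> /eqP].
    exact: ordS_inj.
  apply/eqP/setP => i; rewrite inE; apply/bigcupP;
    exists (ord_pred (f i)) => //.
  by rewrite ffunE inE ord_predK.
rewrite (reindex_onto h h') => [|B /h'K //].
under eq_bigl do rewrite hK eqxx andbT h_part.
rewrite big_mkcond -distr_ffun; apply: eq_bigr => f _; exact: partition_termE.
Qed.

End PartitionSum.

(** * The antipode as a sum over partitions *)

Theorem theorem2p16 (k : closedFieldType) (k_char0 : [pchar k] =i pred0)
  (g : postLieAlgType k)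
  (U : algType k) (iota : g -> U) (U_env : is_enveloping_algebra iota)
  (UU : algType k) (tens : U -> U -> UU)
  (UU_tens : is_tensor_product_algebra tens)
  (Delta : {lrmorphism U -> UU})
  (Delta_gen : forall x : g,
     Delta (iota x) = tens (iota x) 1 + tens 1 (iota x))
  (eps : {lrmorphism U -> k^o}) (eps_gen : forall x : g, eps (iota x) = 0)
  (ext : U -> U -> U) (ext_rhd : is_rhd_extension iota ext)
  (antip : U -> U)
  (antip_antipode :
     is_antipode tens (subadjacent_mul tens Delta ext) 1 Delta eps antip)
  (m : nat) (x : 'I_m -> g) :
  antip (\prod_(i < m) iota (x i)) =
  (-1) ^+ m * \sum_(n < m.+1)
                \sum_(B : {ffun 'I_n.+1 -> {set 'I_m}} | is_partition B)
                  partition_term iota x B.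
Proof.
have iotaL := (enveloping_lie U_env).1.
pose s := [seq x i | i <- enum 'I_m].
have ss : size s = m by rewrite size_map size_enum_ord.
have -> : \prod_(i < m) iota (x i) = word iota s.
  by rewrite /word big_map [index_enum _]unlock -enumT.
rewrite (S_word U_env UU_tens Delta_gen ext_rhd eps_gen antip_antipode
  (@seq_bracket_nil _ g) (@seq_bracket_cons _ g)
  (partition_sum_nil iota) (partition_sum_cons iotaL)).
(* The sign is a scalar of [k] on one side and an element of [U] on the other; the parity of [m]
   links them. *)
rewrite ss -signr_odd scaler_sign -[in RHS]signr_odd mulr_sign /partition_sum ss.
by under [in RHS]eq_bigr do rewrite sum_is_partition.
Qed.
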